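(* Let $G$ be a countable amenable group and let $(F_N)$ be a F\o lner sequence in $G$. Let $E\subseteq G$ with $\bar d_{(F_N)}(E)>0$ and let $\mathbb{X}=(X,\mathcal{B},\mu,(T_g)_{g\in G})$ be a Furstenberg system for the pair $(E,(F_N))$. Then there exists a subsequence $(F_{N_k})$ of $(F_N)$ such that the system $\mathbb{X}$ is isomorphic to the symbolic system $\mathbb{Y}=(Y,\mathcal{B}_Y,\nu,(S_g)_{g\in G})$, where $\omega=(\mathbf{1}_E(g))_{g\in G}\in\{0,1\}^G$, the maps $S_g$ are given by $(S_gx)_{g_0}=x_{g_0g}$ for all $g,g_0\in G$, $Y=\overline{\{S_g\omega: g\in G\}}\subseteq\{0,1\}^G$, $\nu=\textrm{w*-}\lim_{k\to\infty}\frac{1}{|F_{N_k}|}\sum_{g\in F_{N_k}}\delta_{S_g\omega}$ (the weak* limit), and $\mathcal{B}_Y$ is the completion (with respect to $\nu$) of the Borel $\sigma$-algebra of $Y$.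
   Context: A (left) F\o lner sequence in a countable group $G$ is a sequence $(F_N)$ of finite non-empty subsets of $G$ with $\lim_{N\to\infty}|F_N\,\Delta\, gF_N|/|F_N|=0$ for all $g\in G$; $G$ is amenable if it admits one. For $E\subseteq G$, $\bar d_{(F_N)}(E)=\limsup_{N\to\infty}\frac{|E\cap F_N|}{|F_N|}$, and $d_{(F_N)}(E)$ denotes the corresponding limit when it exists. $g^{-1}E=\{h\in G: gh\in E\}$. The space $\{0,1\}^G$ has the product topology. A measure preserving system $(X,\mathcal{B},\mu,(T_g)_{g\in G})$ is a probability space with a measure preserving action $(T_g)_{g\in G}$ of $G$ (so $T_gT_h=T_{gh}$); it is standard if $(X,\mathcal{B},\mu)$ is a Lebesgue space (in particular complete). Definition. Given a countable amenable group $G$, a F\o lner sequence $(F_N)$ and $E\subseteq G$ with $\bar d_{(F_N)}(E)>0$, a standard probability measure preserving system $(X,\mathcal{B},\mu,(T_g)_{g\in G})$ is a Furstenberg system associated with the pair $(E,(F_N))$ if: (1) there is a set $A\in\mathcal{B}$ such that $\mu(A)=\bar d_{(F_N)}(E)>0$; (2) there is a subsequence $(F_{N_k})$ such that for all $r\in\mathbb{N}$ and all $g_1,\dots,g_r\in G$ the limit exists and $d_{(F_{N_k})}(g_1^{-1}E\cap\dots\cap g_r^{-1}E)=\mu((T_{g_1})^{-1}A\cap\dots\cap(T_{g_r})^{-1}A)$; (3) $\mathcal{B}$ is (the completion of) the $\sigma$-algebra generated by $\{T_gA: g\in G\}$. Two systems $(X,\mathcal{B},\mu,(T_g)_{g\in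 G})$ and $(Y,\mathcal{C},\nu,(S_g)_{g\in G})$ are isomorphic if there are full-measure measurable sets $X'\subseteq X$, $Y'\subseteq Y$ with $T_gX'\subseteq X'$, $S_gY'\subseteq Y'$ for all $g$, and a bimeasurable measure preserving bijection $\varphi:X'\to Y'$ with $\varphi(T_gx)=S_g\varphi(x)$ for all $x\in X'$, $g\in G$. *)

(* Defs.v *)
From HB Require Import structures.
From mathcomp Require Import all_boot all_order all_algebra finmap.
From mathcomp Require Import all_classical all_reals all_analysis.
From mathcomp Require Import measurable_realfun.

Set Implicit Arguments.
Unset Strict Implicit.
Unset Printing Implicit Defensive.

Import Order.TTheory GRing.Theory Num.Theory.
Import numFieldNormedType.Exports.

Local Open Scope classical_set_scope.
Local Open Scope ring_scope.

Section Folner.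
Context (R : realType) (G : groupType).
Implicit Types (F : nat -> {fset G}) (E : set G) (g : G).

Definition ltranslate g (A : {fset G}) : {fset G} :=
  [fset (g * h)%g | h in A]%fset.

Definition symdiff (A B : {fset G}) : {fset G} :=
  ((A `\` B) `|` (B `\` A))%fset.

Definition folner F :=
  (forall n, F n != fset0) /\
  forall g, (#|` symdiff (F n) (ltranslate g (F n))|%:R / #|` F n|%:R : R)
              @[n --> \oo] --> (0 : R).

Definition amenable := exists F, folner F.

Definition density_in F E (n : nat) : R :=
  #|` [fset h in F n | h \in E]%fset|%:R / #|` F n|%:R.

Definition upper_density F E : R := limn_sup (density_in F E).

Definition has_density F E (l : R) := density_in F E @ \oo --> l.

(* the set g^-1 E *)
Definition pullback g E : set G := [set h | E (g * h)%g].

Definition subseq_index (N : nat -> nat) := {homo N : i j / (i < j)%N}.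

End Folner.

(* The sets A `|` N, with A measurable and N negligible, already form a
   sigma-algebra ([completion_measurableE]), and the outer measure of A `|` N
   is mu A ([completionU]). *)
Section Completion.
Context d (T : measurableType d) (R : realType) (mu : {measure set T -> \bar R}).
Local Open Scope ereal_scope.

Definition completion_type : Type :=
  g_sigma_algebraType (completed_algebra_gen mu).

HB.instance Definition _ := Measurable.on completion_type.

Lemma completion_measurableE :
  (measurable : set (set completion_type)) = completed_algebra_gen mu.
Proof.
apply/seteqP; split; last first.
  by move=> A cA; exact: sub_sigma_algebra.
apply: smallest_sub => //=; split => /=.
- by exists set0 => //; exists set0; [exact: negligible_set0|rewrite setU0].
- move=> G [/= A mA [N negN ANG]]; case: negN => /= F [mF F0 NF].
  exists (~` A `\` F); first by apply: measurableD => //; exact: measurableC.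
  exists (~` G `&` F); first by exists F; split => // x [].
  rewrite setTD -ANG; apply/seteqP; split => x /=.
    move=> [[nAx nFx]|[]//]; apply/not_orP; split => // /NF; exact: nFx.
  move=> /not_orP[nAx nNx].
  have [Fx|nFx] := pselect (F x); last by left.
  by right; split => //; apply/not_orP.
- move=> F mF /=.
  have /choice[AN ANP] : forall n, exists AN : set T * set T,
      [/\ measurable AN.1, mu.-negligible AN.2 & AN.1 `|` AN.2 = F n].
    by move=> n; have [A mA [N nN <-]] := mF n; exists (A, N).
  exists (\bigcup_k (AN k).1).
    by apply: bigcupT_measurable => k; have [] := ANP k.
  exists (\bigcup_k (AN k).2).
    by apply: negligible_bigcup => k; have [] := ANP k.
  by rewrite -bigcupU; apply: eq_bigcup => // k _; have [_ _ <-] := ANP k.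
Qed.

Definition completion : set completion_type -> \bar R := (mu^*)%mu.

Lemma completionU (A N : set T) :
  measurable A -> mu.-negligible N -> completion (A `|` N) = mu A.
Proof.
move=> mA [M [mM M0 NM]]; apply/eqP; rewrite eq_le; apply/andP; split.
  rewrite -(measurable_mu_extE mu mA).
  have /le_trans -> // := outer_measureU2 (mu^*)%mu A N.
  have /le_trans : ((mu^*)%mu N <= (mu^*)%mu M)%E by exact: le_mu_ext.
  rewrite (measurable_mu_extE mu mM) M0 => /(_ 0 (lexx _)) N0.
  by rewrite -[leRHS]adde0 leeD2l.
by rewrite -(measurable_mu_extE mu mA); apply: le_mu_ext; exact: subsetUl.
Qed.

Let completion_cara :
  (measurable : set (set completion_type)) `<=` (mu^*)%mu.-cara.-measurable.
Proof.
rewrite completion_measurableE => _ [A mA [N [M [mM M0 NM]] <-]].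
apply: measurableU; first exact: caratheodory_measurable_mu_ext.
apply: (@measure_is_complete_caratheodory R T (mu^*)%mu).
exists M; split => //; first exact: caratheodory_measurable_mu_ext.
by rewrite /= measurable_mu_extE.
Qed.

Let completion0 : completion set0 = 0.
Proof. exact: outer_measure0. Qed.

Let completion_ge0 A : 0 <= completion A.
Proof. exact: outer_measure_ge0. Qed.

Let completion_sigma_additive : semi_sigma_additive completion.
Proof.
move=> F mF tF mUF; apply: caratheodory_measure_sigma_additive => //.
  by move=> i; exact: completion_cara.
exact: completion_cara.
Qed.

HB.instance Definition _ := isMeasure.Build _ _ _ completion
  completion0 completion_ge0 completion_sigma_additive.

End Completion.
Arguments completion {d T R} mu A.

Section CompletionProbability.
Context d (T : measurableType d) (R : realType) (P : probability T R).

Let completion_setT : completion P setT = 1%E.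
Proof.
rewrite -(setU0 [set: completion_type P]) completionU //.
  exact: probability_setT.
exact: negligible_set0.
Qed.

HB.instance Definition _ := Measure_isProbability.Build _ _ _
  (completion P) completion_setT.

End CompletionProbability.

Record mod0_isomorphism (R : realType)
    d1 (X : measurableType d1) (mu : {measure set X -> \bar R})
    d2 (Y : measurableType d2) (nu : {measure set Y -> \bar R})
    (X' : set X) (Y' : set Y) (phi : X -> Y) : Prop := Mod0Isomorphism {
  mod0_dom : measurable X' /\ mu (~` X') = 0%E ;
  mod0_codom : measurable Y' /\ nu (~` Y') = 0%E ;
  mod0_bij : set_bij X' Y' phi ;
  mod0_measurable : forall B, measurable B -> B `<=` Y' ->
    measurable (X' `&` phi @^-1` B) ;
  mod0_measurable_inv : forall A, measurable A -> A `<=` X' ->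
    measurable (phi @` A) ;
  mod0_preserving : forall B, measurable B -> B `<=` Y' ->
    mu (X' `&` phi @^-1` B) = nu B }.

Section LebesgueSpace.
Context (R : realType).

(* Lebesgue measure on [0, s] together with a mass p n at the point -(n+1),
   so that the atoms lie outside the interval; the value p n = 0 is allowed,
   hence the number of atoms may be finite. *)
Definition interval_and_atoms (s : {nonneg R}) (p : nat -> {nonneg R}) :
    {measure set (measurableTypeR R) -> \bar R} :=
  measure_add
    (mrestr (@lebesgue_measure R)
       (measurable_itv `[0, s%:num] : measurable (_ : set (measurableTypeR R))))
    (mseries (fun n => mscale (p n) \d_(- n.+1%:R : measurableTypeR R)) 0).

(* A complete probability space isomorphic mod 0 to the disjoint union of an
   interval with Lebesgue measure and countably many atoms; the isomorphism
   forces the total mass of the model to be 1. *)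
Definition lebesgue_space d (X : measurableType d) (mu : probability X R) :=
  measure_is_complete mu /\
  exists (s : {nonneg R}) (p : nat -> {nonneg R}) X' Y' phi,
    @mod0_isomorphism R _ X mu
      _ (completion_type (interval_and_atoms s p))
      (completion (interval_and_atoms s p)) X' Y' phi.

End LebesgueSpace.

Section Systems.
Context (R : realType) (G : groupType).

Record mp_system d (X : measurableType d) (mu : probability X R)
    (T : G -> X -> X) : Prop := MpSystem {
  mp_act1 : forall x, T 1%g x = x ;
  mp_actM : forall g h x, T (g * h)%g x = T g (T h x) ;
  mp_measurable : forall g, measurable_fun setT (T g) ;
  mp_preserving : forall g B, measurable B -> mu (T g @^-1` B) = mu B }.

Definition isomorphic_systems
    d1 (X : measurableType d1) (mu : probability X R) (T : G -> X -> X)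
    d2 (Y : measurableType d2) (nu : probability Y R) (S : G -> Y -> Y) :=
  exists (X' : set X) (Y' : set Y) (phi : X -> Y),
    [/\ mod0_isomorphism mu nu X' Y' phi,
        forall g, T g @` X' `<=` X',
        forall g, S g @` Y' `<=` Y' &
        forall g x, X' x -> phi (T g x) = S g (phi x)].

Definition generated_by_translates d (X : measurableType d)
    (mu : probability X R) (T : G -> X -> X) (A : set X) :=
  let gen := [set T g @` A | g in [set: G]] in
  (measurable : set (set X)) =
  completed_algebra_gen (mu : set (g_sigma_algebraType gen) -> \bar R).

Definition furstenberg_system (E : set G) (F : nat -> {fset G})
    d (X : measurableType d) (mu : probability X R) (T : G -> X -> X) :=
  [/\ lebesgue_space mu, mp_system mu T &
    exists A : set X,
      [/\ measurable A,
          mu A = (upper_density R F E)%:E /\ 0 < upper_density R F E,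
          exists2 N, subseq_index N &
            forall (r : nat) (g : 'I_r -> G), (0 < r)%N ->
              has_density (F \o N) (\bigcap_i pullback (g i) E)
                (fine (mu (\bigcap_i (T (g i) @^-1` A)))) &
          generated_by_translates mu T A]].

End Systems.

Section Symbolic.
Context (G : groupType).

Definition shift (g : G) (x : {ptws G -> bool}) : {ptws G -> bool} :=
  fun g0 => x (g0 * g)%g.

Definition indicator_seq (E : set G) : {ptws G -> bool} := fun g => g \in E.

Definition orbit_closure (E : set G) : set {ptws G -> bool} :=
  closure [set shift g (indicator_seq E) | g in [set: G]].

Lemma shift1 x : shift 1%g x = x.
Proof. by apply/funext => g0; rewrite /shift mulg1. Qed.

Lemma shiftM g h x : shift (g * h)%g x = shift g (shift h x).
Proof. by apply/funext => g0; rewrite /shift mulgA. Qed.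

Lemma continuous_shift g : continuous (shift g).
Proof.
move=> x; apply/cvg_sup => g0 B [_ [[V oV <-] /= Vx] VB].
apply: filterS VB _.
have := @proj_continuous G (fun=> bool) (g0 * g)%g x V.
by apply; apply: open_nbhs_nbhs.
Qed.

Lemma orbit_closure_indicator E : orbit_closure E (indicator_seq E).
Proof. by apply: subset_closure; exists 1%g => //; exact: shift1. Qed.

Lemma orbit_closure_shift E g x :
  orbit_closure E x -> orbit_closure E (shift g x).
Proof.
move=> Ex B /(continuous_shift (g := g)) /Ex[_ [[h _ <-] Bh]].
by exists (shift (g * h)%g (indicator_seq E)); split;
  [exists (g * h)%g|rewrite shiftM].
Qed.

Context (E : set G).

Definition symbolic_space : Type := set_type (orbit_closure E).

Definition symbolic_point : symbolic_space :=
  exist _ (indicator_seq E) (mem_set (@orbit_closure_indicator E)).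

HB.instance Definition _ := Topological.on symbolic_space.
HB.instance Definition _ := isPointed.Build symbolic_space symbolic_point.

Definition symbolic_shift (g : G) (y : symbolic_space) : symbolic_space :=
  exist _ (shift g (val y))
    (mem_set (@orbit_closure_shift E g _ (set_mem (valP y)))).

End Symbolic.

Section WeakStar.
Context (R : realType) (Y : ptopologicalType).

Definition borel_type : Type := g_sigma_algebraType (@open Y).
HB.instance Definition _ := Measurable.on borel_type.

(* For compact Y, so that every continuous function is bounded. *)
Definition weak_star_cvg (nu_ : nat -> {measure set borel_type -> \bar R})
    (nu : {measure set borel_type -> \bar R}) :=
  forall f : Y -> R, continuous f ->
    (\int[nu_ k]_(x in [set: borel_type]) (f x)%:E)%E @[k --> \oo] -->
    (\int[nu]_(x in [set: borel_type]) (f x)%:E)%E.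

End WeakStar.

Definition borel_symbolic (G : groupType) (E : set G) :=
  borel_type (symbolic_space E).

(* (1 / #|A|) * \sum_(g in A) \d_(S_g omega), where omega = indicator_seq E;
   [empiricalE] puts the enumerated sum in this form. *)
Definition empirical (R : realType) (G : groupType) (E : set G) (A : {fset G}) :
    {measure set (borel_symbolic E) -> \bar R} :=
  mscale (#|` A|%:R^-1)%:nng
    (msum (fun i => \d_(symbolic_shift (nth 1%g A i) (symbolic_point E)
                         : borel_symbolic E)) #|` A|).

Lemma empiricalE (R : realType) (G : groupType) (E : set G) (A : {fset G})
    (B : set (borel_symbolic E)) :
  empirical R E A B = ((#|` A|%:R^-1)%:E *
    \sum_(g <- A) \d_(symbolic_shift g (symbolic_point E)
                        : borel_symbolic E) B)%E.
Proof.
by rewrite /empirical /= /mscale /= /msum (big_nth 1%g) big_mkord.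
Qed.

(* Main.v *)
Require Import Defs.
From HB Require Import structures.
From mathcomp Require Import all_boot all_order all_algebra finmap.
From mathcomp Require Import all_classical all_reals all_analysis.
From mathcomp Require Import measurable_realfun.
From mathcomp Require Import ring lra.

(** The system is coded by its distinguished set A: a point x goes to the 0-1
    sequence recording for which g the translate [T g x] lies in A, which turns
    the action into the shift.  Everything below serves to see that this coding
    is an isomorphism onto the orbit closure Y of the indicator of E.

    _The image measure is the weak* limit._  The correspondence between densities
    and measures of intersections of translates of A extends, by inclusion and
    exclusion, to patterns prescribing finitely many ones and zeros
    ([density_cylinder]).  So the image measure of a cylinder is the limit of the
    empirical measures of that cylinder, and uniform continuity on the compact
    space Y upgrades this to weak* convergence ([weak_star_cylinder]).  A cylinder
    missing Y has density zero, hence almost every point is coded into Y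
    ([coding_orbit_closure]).  Shift invariance of the limit is inherited from
    the invariance of mu.

    _The coding is injective and bimeasurable off a null set._  As the translates
    of A generate the sigma-algebra up to null sets, every measurable set is, up
    to null sets, the preimage of a Borel subset of Y.  Identify X with a
    subset of the real line.  Applied to the preimages of the rational half-lines
    this yields a Borel function theta on Y which recovers the real coordinate of
    a point from its code; in particular almost all points are determined by
    their codes.  The remaining question is whether images are measurable.  It
    can be answered without analytic sets, since after discarding a null set the
    map from real coordinates to codes is Borel as well, and then the image of
    the coding is the set of those y which are the code of the point of
    coordinate theta(y): a Borel condition on y ([factor_injective_bimeasurable]).

    Intersecting with the countably many translates makes the good set
    invariant, and the isomorphism follows ([symbolic_factor_isomorphism]). *)

Import Order.TTheory GRing.Theory Num.Theory.
Import numFieldNormedType.Exports.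

Local Open Scope classical_set_scope.
Local Open Scope ring_scope.

(** * Cylinders in the space of 0-1 sequences *)

Lemma countable_surj (T : Type) (t : T) : countable [set: T] ->
  exists e : nat -> T, forall x, exists n, e n = x.
Proof.
move=> /countable_injP[f finj].
have /choice[e eP] : forall n, exists x, forall y, f y = n -> x = y.
  move=> n; have [[y fy]|nf] := pselect (exists y, f y = n).
    by exists y => z fz; apply: finj; rewrite ?inE// fy fz.
  by exists t => y fy; exfalso; apply: nf; exists y.
by exists e => x; exists (f x); exact: eP.
Qed.

Section Cylinders.
Context {G : groupType}.
Implicit Types (P Q L : seq G) (x y : {ptws G -> bool}).

Definition cylinder P Q : set {ptws G -> bool} :=
  [set y | all (fun g => y g) P && all (fun g => ~~ y g) Q].

Lemma cylinder_nil : cylinder [::] [::] = setT.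
Proof. by apply/seteqP; split. Qed.

Lemma cylinder_consl g P Q :
  cylinder (g :: P) Q = cylinder P Q `&` [set y | y g].
Proof.
apply/seteqP; split => y; rewrite /cylinder /=.
  by move=> /andP[/andP[yg yP] yQ]; split => //; apply/andP.
by move=> [/andP[yP yQ] yg]; rewrite yg yP yQ.
Qed.

(** This form of the zero constraint drives the inductions by inclusion and
    exclusion: each zero in a pattern is traded for patterns with fewer zeros. *)
Lemma cylinder_consr g P Q :
  cylinder P (g :: Q) = cylinder P Q `\` cylinder (g :: P) Q.
Proof.
apply/seteqP; split => y; rewrite /cylinder /=.
  by move=> /andP[yP /andP[yg yQ]]; rewrite yP yQ (negbTE yg).
by move=> [/andP[-> ->]]; case: (y g).
Qed.

Lemma cylinder_split g P Q :
  cylinder P Q = cylinder (g :: P) Q `|` cylinder P (g :: Q).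
Proof.
by rewrite cylinder_consr setDUK// cylinder_consl; exact: subIsetl.
Qed.

Definition agree L x y := {in L, forall g, y g = x g}.

Lemma agree_cylinder L x :
  cylinder [seq g <- L | x g] [seq g <- L | ~~ x g] = [set y | agree L x y].
Proof.
apply/seteqP; split => y; rewrite /cylinder /agree /=.
  move=> /andP[/allP yP /allP yQ] g gL.
  have [xg|nxg] := boolP (x g); first by apply: yP; rewrite mem_filter xg.
  by apply/negbTE/yQ; rewrite mem_filter nxg.
move=> yx; apply/andP; split; apply/allP => g; rewrite mem_filter.
  by move=> /andP[xg /yx ->].
by move=> /andP[xg /yx ->].
Qed.

(** The sets containing a class of sequences agreeing with x on a finite list form
    a filter, and the universal property of the product topology says that this
    filter converges to x. *)
Lemma nbhs_agree x (U : set {ptws G -> bool}) :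
  nbhs x U -> exists L, [set y | agree L x y] `<=` U.
Proof.
pose Fx : set_system {ptws G -> bool} :=
  [set V | exists L, [set y | agree L x y] `<=` V].
have FF : Filter Fx.
  split; first by exists [::].
    move=> V W [L LV] [M MW]; exists (L ++ M) => y yx; split.
      by apply: LV => g gL; apply: yx; rewrite mem_cat gL.
    by apply: MW => g gM; apply: yx; rewrite mem_cat gM orbT.
  by move=> V W VW [L LV]; exists L; exact: subset_trans VW.
suff : Fx --> x by apply.
apply/cvg_sup => g B [_ [[V oV <-] /= Vx] VB].
by exists [:: g] => y yx; apply: VB; rewrite /= yx// inE.
Qed.

Lemma open_cylinder P Q : open (cylinder P Q).
Proof.
have op g b : open [set y : {ptws G -> bool} | y g = b].
  pose pr : {ptws G -> bool} -> bool := proj g.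
  have prc : continuous pr := @proj_continuous G (fun=> bool) g.
  have /continuousP/(_ [set b]) := prc.
  by apply; exact: discrete_open.
elim: P => [|g P IH]; last first.
  by rewrite cylinder_consl; apply: openI => //; exact: op.
elim: Q => [|g Q IH]; first by rewrite cylinder_nil; exact: openT.
rewrite [X in open X](_ : _ = cylinder [::] Q `&` [set y | y g = false]).
  by apply: openI => //; exact: op.
rewrite cylinder_consr cylinder_consl; apply/seteqP; split => y /=.
  by move=> [yQ yg]; split => //; apply/negbTE/negP => yg'; apply: yg.
by move=> [yQ yg]; split => // -[_]; rewrite yg.
Qed.

(** The sequence c enumerates all patterns; restricting the union to the indices
    whose cylinder fits in U keeps it countable, so that measurability and
    nullity of open sets can be checked on cylinders. *)
Lemma cylinder_base : countable [set: G] ->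
  exists c : nat -> seq G * seq G, forall U : set {ptws G -> bool}, open U ->
    U = \bigcup_(n in [set n | cylinder (c n).1 (c n).2 `<=` U])
          cylinder (c n).1 (c n).2.
Proof.
move=> /(countable_surj _ 1%g)[e /choice[r er]].
pose c n : seq G * seq G :=
  if (choice.unpickle n : option (seq nat * seq nat)) is Some st
  then (map e st.1, map e st.2) else ([::], [::]).
have cs P Q : exists n, c n = (P, Q).
  exists (choice.pickle (map r P, map r Q)); rewrite /c choice.pickleK /= -!map_comp.
  by congr (_, _); rewrite -[RHS]map_id; apply: eq_map => g /=.
exists c => U oU; apply/seteqP; split => [x Ux|x [n nU] /nU//].
have [L LU] := @nbhs_agree x U (open_nbhs_nbhs (conj oU Ux)).
have [n cn] := cs [seq g <- L | x g] [seq g <- L | ~~ x g].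
by exists n; rewrite /= cn /= agree_cylinder.
Qed.

End Cylinders.

(** * Measurable sets of a completion *)

Section CompletionTheory.
Context {d} {T : measurableType d} {R : realType} (m : {measure set T -> \bar R}).

(** Sandwiching a set between Borel sets that differ by a null set is more convenient
    than writing it as a union, as the bounds can be transported by maps. *)
Lemma completion_measurableP (S : set T) :
  measurable (S : set (completion_type m)) <->
  exists B L : set T,
    [/\ measurable B, measurable L, m L = 0%E, B `<=` S & S `<=` B `|` L].
Proof.
rewrite completion_measurableE; split.
  move=> [B mB [N [L [mL L0 NL]] <-]]; exists B, L; split => //.
  exact: setUS.
move=> [B [L [mB mL L0 BS SBL]]]; exists B => //; exists (S `&` L).
  by exists L; split => // x [].
apply/seteqP; split => x; first by case => [/BS|[]].
by move=> Sx; case: (SBL _ Sx) => [?|?]; [left|right].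
Qed.

Lemma measurable_completion (B : set T) :
  measurable B -> measurable (B : set (completion_type m)).
Proof.
by move=> mB; apply/completion_measurableP; exists B, set0; split.
Qed.

Lemma completionE (B : set T) : measurable B -> completion m B = m B.
Proof.
by move=> mB; rewrite -{1}(setU0 B) completionU//; exact: negligible_set0.
Qed.

Lemma completion_between (B S L : set T) : measurable B -> measurable L ->
  m L = 0%E -> B `<=` S -> S `<=` B `|` L -> completion m S = m B.
Proof.
move=> mB mL L0 BS SBL; rewrite (_ : S = B `|` (S `&` L)).
  by apply: completionU => //; exists L; split => // x [].
apply/seteqP; split => x; last by case => [/BS|[]].
by move=> Sx; case: (SBL _ Sx) => ?; [left|right].
Qed.

Lemma completion_eq0P (S : set T) :
  (measurable (S : set (completion_type m)) /\ completion m S = 0%E) <->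
  m.-negligible S.
Proof.
split=> [[mS S0]|[L [mL L0 SL]]].
  have /completion_measurableP[B [L [mB mL L0 BS SBL]]] := mS.
  exists (B `|` L); split => //; first exact: measurableU.
  have mB0 : m B = 0%E.
    rewrite -completionE//; apply/eqP; rewrite -measure_le0 -[leRHS]S0.
    by apply: le_measure; rewrite ?inE//; exact: measurable_completion.
  apply: measure_negligible; first exact: measurableU.
  by apply: negligibleU; exact/negligibleP.
have mS : measurable (S : set (completion_type m)).
  by apply/completion_measurableP; exists set0, L; split => //; rewrite set0U.
split=> //; apply/eqP; rewrite -measure_le0; move: L0; rewrite -completionE// => L0.
rewrite -[leRHS]L0.
by apply: le_measure; rewrite ?inE//; exact: measurable_completion.
Qed.

End CompletionTheory.

(** * Factors of a Lebesgue space that carry the whole sigma-algebra *)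

Section FactorOfLebesgueSpace.
Context (R : realType) d (X : measurableType d) (mu : probability X R).
Context d' (Y : measurableType d') (phi : X -> Y) (V : nat -> set Y) (X1 : set X).
Hypothesis leb : lebesgue_space mu.
Hypothesis mV : forall n, measurable (V n).
Hypothesis sepV : forall y y', (forall n, V n y <-> V n y') -> y = y'.
Hypothesis mphi : measurable_fun setT phi.
Hypothesis mX1 : measurable X1.
Hypothesis X1full : mu (~` X1) = 0%E.
(* X1 is there because a map into the support of its image measure need only be
   meaningful almost everywhere: the points outside X1 may be sent to an atom, so
   the exceptional set cannot be absorbed in the preimage of M. *)
Hypothesis approx : forall A, measurable A -> exists D M : set Y,
  [/\ measurable D, measurable M, mu (phi @^-1` M) = 0%E &
      forall x, X1 x -> ~ M (phi x) -> A x <-> D (phi x)].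

(** Let psi be the real coordinate on X.  Approximating the preimages of the
    half-lines gives theta with [theta (phi x) = psi x]; conversely the sets
    [psi @` (phi @^-1` V n)] agree with Borel sets of reals up to null sets.
    Deleting all these null sets leaves X2, on which phi and psi determine each
    other in a Borel way, and [phi @` X2] is cut out by the countably many
    conditions forming the set I of the proof. *)
Lemma factor_injective_bimeasurable : exists X2 : set X,
  [/\ measurable X2, mu (~` X2) = 0%E, X2 `<=` X1, {in X2 &, injective phi} &
      forall A, measurable A -> A `<=` X2 -> exists B L : set Y,
        [/\ measurable B, measurable L, mu (phi @^-1` L) = 0%E,
            B `<=` phi @` A & phi @` A `<=` B `|` L]].
Proof.
have mpre B : measurable B -> measurable (phi @^-1` B).
  by move=> mB; rewrite -[X in measurable X]setTI; exact: mphi.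
have [compl [s [p [X0 [Z0 [psi iso]]]]]] := leb.
pose m := interval_and_atoms s p; rewrite -/m in iso.
have [[mX0 X0full] [mZ0 Z0full] [psiZ psi_inj psi_surj] psi_pre psi_im pres] := iso.
pose Q q := X0 `&` psi @^-1` (`]-oo, ratr q]%classic `&` Z0).
have mQ q : measurable (Q q).
  apply: psi_pre; last exact: subIsetr.
  by apply: measurableI => //; apply: measurable_completion; exact: measurable_itv.
(* (DM q).1 is a Borel set of Y representing the half-line below q,
   and (DM q).2 contains the codes at which the representation fails. *)
have /choice[DM DMP] : forall q, exists DM : set Y * set Y,
    [/\ measurable DM.1, measurable DM.2, mu (phi @^-1` DM.2) = 0%E &
      forall x, X1 x -> ~ DM.2 (phi x) -> Q q x <-> DM.1 (phi x)].
  by move=> q; have [D [M]] := approx _ (mQ q); exists (D, M).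
(* The same on the real side: BL n gives a Borel set of coordinates representing
   V n, together with a null set covering the error. *)
have /choice[BL BLP] : forall n, exists BL : set R * set R,
    [/\ measurable (BL.1 : set (measurableTypeR R)),
        measurable (BL.2 : set (measurableTypeR R)), m BL.2 = 0%E,
        BL.1 `<=` psi @` (X0 `&` phi @^-1` V n) &
        psi @` (X0 `&` phi @^-1` V n) `<=` BL.1 `|` BL.2].
  move=> n; have /psi_im/(_ (@subIsetl _ _ _)) : measurable (X0 `&` phi @^-1` V n).
    by apply: measurableI => //; exact: mpre.
  by move=> /completion_measurableP[B [L]]; exists (B, L).
have /completion_measurableP[Z1 [LZ [mZ1 mLZ LZ0 Z1Z0 Z0Z1]]] := mZ0.
have [e esurj] := countable_surj _ (0 : rat) (countableP _).
(* S collects the points whose code is not reliable; it is removed through its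
   image on the line, so that the set that is left has a Borel image there. *)
pose S := X0 `&` (~` X1 `|` \bigcup_n (phi @^-1` (DM (e n)).2)).
have mbad : measurable (\bigcup_n (phi @^-1` (DM (e n)).2)).
  by apply: bigcupT_measurable => n; have [_ + _ _] := DMP (e n); exact: mpre.
have mS : measurable S.
  by apply: measurableI => //; apply: measurableU => //; exact: measurableC.
have S0 : mu S = 0%E.
  apply: measure_negligible => //.
  apply: (@negligibleS _ _ _ _ (~` X1 `|` \bigcup_n (phi @^-1` (DM (e n)).2))).
    exact: subIsetr.
  apply: negligibleU; first by apply/negligibleP => //; exact: measurableC.
  apply: negligible_bigcup => n; have [_ mD D0 _] := DMP (e n).
  by apply/negligibleP => //; exact: mpre.
have [L' [mL' L'0 SL']] : m.-negligible (psi @` S).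
  apply/completion_eq0P; split; first by apply: psi_im => //; exact: subIsetl.
  have SZ : psi @` S `<=` Z0 by move=> _ [x [X0x _] <-]; exact: psiZ.
  have SE : X0 `&` psi @^-1` (psi @` S) = S.
    apply/seteqP; split => x.
      move=> [X0x [x' Sx' /psi_inj]].
      by rewrite !inE => /(_ (proj1 Sx') X0x) <-.
    by move=> Sx; split; [exact: (proj1 Sx)|exists x].
  by rewrite -pres ?SE//; apply: psi_im => //; exact: subIsetl.
pose Null := LZ `|` (L' `|` \bigcup_n (BL n).2).
have mNull : measurable (Null : set (measurableTypeR R)).
  by do !apply: measurableU => //; apply: bigcupT_measurable => n; have [] := BLP n.
have Null0 : m.-negligible Null.
  apply: negligibleU; first exact/negligibleP.
  apply: negligibleU; first exact/negligibleP.
  by apply: negligible_bigcup => n; have [_ ? ? _ _] := BLP n; exact/negligibleP.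
pose Zb := Z1 `\` Null.
have mZb : measurable (Zb : set (measurableTypeR R)) by exact: measurableD.
have ZbZ0 : Zb `<=` Z0 by move=> z [/Z1Z0].
pose X2 := X0 `&` psi @^-1` Zb.
have mX2 : measurable X2.
  by apply: psi_pre => //; exact: measurable_completion.
have X2good x : X2 x -> X1 x /\ forall q, ~ (DM q).2 (phi x).
  move=> [X0x [_ nN]]; apply: contrapT => nP; apply: nN; right; left; apply: SL'.
  exists x => //; split => //; have [X1x|] := pselect (X1 x); last by left.
  right; apply: contrapT => nB; apply: nP; split => // q Mq; apply: nB.
  by have [n en] := esurj q; exists n => //=; rewrite en.
(* theta inverts z |-> [set q | z <= ratr q]. *)
pose theta : Y -> \bar R := fun y =>
  ereal_inf [set (ratr q : R)%:E | q in [set q : rat | (DM q).1 y]].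
have mtheta : measurable_fun setT theta.
  apply: (measurability _ (ErealGenInftyO.measurableE R)) => _ /= -[_ [r ->] <-].
  rewrite setTI [X in measurable X](_ : _ =
    \bigcup_(q in [set q : rat | ratr q < r]) (DM q).1).
    rewrite bigcup_mkcond; apply: bigcupT_measurable_rat => q.
    by case: ifPn => // _; have [] := DMP q.
  apply/seteqP; split => y; rewrite /= in_itv /=.
    by move=> /ereal_inf_lt[_ [q Dq <-]]; rewrite lte_fin => qr; exists q.
  move=> [q qr Dq]; rewrite (@le_lt_trans _ _ (ratr q : R)%:E)// ?lte_fin//.
  by apply: ereal_inf_lbound; exists q.
have theta_phi x : X2 x -> theta (phi x) = (psi x)%:E.
  move=> X2x; have [X1x nM] := X2good _ X2x; have [X0x _] := X2x.
  have DE q : (DM q).1 (phi x) <-> psi x <= ratr q.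
    have [_ _ _ /(_ _ X1x (nM q)) <-] := DMP q.
    split => [[_ []]|xq]; first by rewrite /= in_itv.
    by split => //; split; rewrite /= ?in_itv//; exact: psiZ.
  apply/eqP; rewrite eq_le; apply/andP; split.
    apply/lee_addgt0Pr => t t0.
    have /rat_in_itvoo[q /itvP qre] : psi x < psi x + t by rewrite ltrDl.
    rewrite (@le_trans _ _ (ratr q : R)%:E)// -?EFinD ?lee_fin ?qre//.
    by apply: ereal_inf_lbound; exists q => //; apply/DE; rewrite qre.
  by apply/ereal_infP => _ [q /DE xq <-]; rewrite lee_fin.
have mtheta' B : measurable (B : set (measurableTypeR R)) ->
    measurable (theta @^-1` (EFin @` B)).
  move=> mB; rewrite -[X in measurable X]setTI; apply: mtheta => //.
  exact: measurable_image_EFin.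
(* y lies in I when theta y is the coordinate of a point of X2 whose code has
   the same memberships in the V n as y, hence is equal to y. *)
pose I := theta @^-1` (EFin @` Zb) `&` \bigcap_n
  ((theta @^-1` (EFin @` (BL n).1) `&` V n) `|`
   (~` (theta @^-1` (EFin @` (BL n).1)) `&` ~` V n)).
have mI : measurable I.
  apply: measurableI; first exact: mtheta'.
  apply: bigcapT_measurable => n; have [mB _ _ _ _] := BLP n.
  by apply: measurableU; apply: measurableI => //;
    try apply: measurableC => //; exact: mtheta'.
have BLV n x : X2 x -> (BL n).1 (psi x) <-> V n (phi x).
  move=> X2x; have [_ _ _ Bsub subB] := BLP n; have [X0x [_ nN]] := X2x; split.
    move=> /Bsub[x' [X0x' Vx']] /psi_inj; rewrite !inE => /(_ X0x' X0x) <- //.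
  move=> Vx; have [|//|Lx] := subB (psi x); first by exists x.
  by exfalso; apply: nN; right; right; exists n.
have phiX2 : phi @` X2 = I.
  apply/seteqP; split => [_ [x X2x <-]|y [[z Zbz tz] Iy]].
    split; first by exists (psi x); [case: X2x|rewrite theta_phi].
    move=> n _ /=; have [Vx|nVx] := pselect (V n (phi x)).
      by left; split => //; exists (psi x); [exact/BLV|rewrite theta_phi].
    right; split => // -[z Bz]; rewrite theta_phi// => -[zx].
    by apply: nVx; apply/BLV => //; rewrite -zx.
  have [x X0x xz] := psi_surj _ (ZbZ0 _ Zbz).
  have X2x : X2 x by split => //=; rewrite xz.
  exists x => //; apply: sepV => n; rewrite -BLV// xz.
  case: (Iy n Logic.I) => /= [[[z' Bz'] + Vy]|[nB nVy]].
    by rewrite -tz => -[zz']; split => // _; rewrite -zz'.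
  by split => // Bz; exfalso; apply: nB; exists z.
exists X2; split => //.
- have nN : completion m (Z0 `\` Zb) = 0%E /\
      measurable (Z0 `\` Zb : set (completion_type m)).
    suff /completion_eq0P[] : m.-negligible (Z0 `\` Zb) by [].
    apply: negligibleS Null0 => z [Z0z nZbz].
    have [Z1z|Lz] := Z0Z1 _ Z0z; last by left.
    by apply: contrapT => nNz; apply: nZbz.
  apply: measure_negligible; first exact: measurableC.
  apply: (@negligibleS _ _ _ _ (~` X0 `|` X0 `&` psi @^-1` (Z0 `\` Zb))).
    move=> x nX2x; have [X0x|] := pselect (X0 x); last by left.
    right; split => //; split; first exact: psiZ.
    by move=> Zbx; apply: nX2x.
  apply: negligibleU; first by apply/negligibleP => //; exact: measurableC.
  have ZZ : Z0 `\` Zb `<=` Z0 by exact: subDsetl.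
  apply/negligibleP; first by apply: psi_pre => //; exact: (proj2 nN).
  exact: etrans (pres _ (proj2 nN) ZZ) (proj1 nN).
- by move=> x /X2good[].
- move=> x x'; rewrite !inE => X2x X2x' xx'.
  have /psi_inj : psi x = psi x' by apply: EFin_inj; rewrite -!theta_phi// xx'.
  by apply; rewrite inE; [case: X2x|case: X2x'].
move=> A mA AX2; have [D [M [mD mM M0 AD]]] := approx _ mA.
(* Off M, membership in A is read off from the code alone. *)
exists (D `&` I `\` M), M; split => //.
- by apply: measurableD => //; exact: measurableI.
- move=> y [[Dy]]; rewrite -phiX2 => -[x X2x xy] My; exists x => //.
  by apply/AD; rewrite ?xy//; have [] := X2good _ X2x.
- move=> _ [x Ax <-]; have [|nM] := pselect (M (phi x)); [by right|left].
  split => //; split; first by apply/AD => //; have [] := X2good _ (AX2 _ Ax).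
  by rewrite -phiX2; exists x => //; exact: AX2.
Qed.

End FactorOfLebesgueSpace.

(** * Densities of patterns *)

Section DensityAlgebra.
Context {R : realType} {G : groupType}.
Implicit Types (F : nat -> {fset G}) (D : set G).

Lemma density_inE F D n :
  density_in R F D n = #|` F n|%:R^-1 * \sum_(h <- F n) \1_D h.
Proof.
rewrite /density_in mulrC; congr (_ * _).
rewrite card_fset_sum1 big_fset natr_sum [RHS](bigID (mem D))/=.
rewrite [X in _ = _ + X]big1 ?addr0; last first.
  by move=> h; rewrite indicE => /negbTE ->.
by apply: eq_bigr => h hD; rewrite indicE hD.
Qed.

Lemma density_inT F n : F n != fset0 -> density_in R F setT n = 1.
Proof.
move=> Fn; rewrite density_inE; under eq_bigr do rewrite indicT.
rewrite big_const_seq count_predT iter_addr_0 mulVf//.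
by rewrite pnatr_eq0 cardfs_eq0.
Qed.

Lemma density_in0 F n : density_in R F set0 n = 0.
Proof. by rewrite density_inE big1 ?mulr0// => h _; rewrite indic0. Qed.

Lemma density_inD F D D' n : D' `<=` D ->
  density_in R F (D `\` D') n = density_in R F D n - density_in R F D' n.
Proof.
move=> D'D; rewrite !density_inE -mulrBr -sumrB; congr (_ * _).
apply: eq_bigr => h _; rewrite !indicE in_setD.
have [hD'|] := boolP (h \in D'); last by rewrite subr0 andbT.
by rewrite andbF (_ : h \in D) ?subrr//; move: hD'; rewrite !inE; exact: D'D.
Qed.

Lemma empirical_density F E n (B : set (borel_symbolic E)) :
  empirical R E (F n) B =
  (density_in R F [set h | B (symbolic_shift h (symbolic_point E))] n)%:E.
Proof.
by rewrite empiricalE density_inE EFinM -sumEFin.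
Qed.

End DensityAlgebra.

Section Coding.
Context {R : realType} {G : groupType} {d} {X : measurableType d}.
Context (mu : probability X R) (T : G -> X -> X) (A : set X).
Hypothesis sysT : mp_system mu T.
Hypothesis mA : measurable A.

Definition coding (x : X) : {ptws G -> bool} := fun g => T g x \in A.

Lemma coding_equivariant g x : coding (T g x) = Defs.shift g (coding x).
Proof.
by apply/funext => h; rewrite /coding /Defs.shift (mp_actM sysT).
Qed.

Lemma measurable_translate g B : measurable B -> measurable (T g @^-1` B).
Proof.
by move=> mB; rewrite -[X in measurable X]setTI; exact: (mp_measurable sysT).
Qed.

Lemma measurable_coding_cylinder P Q :
  measurable (coding @^-1` cylinder P Q).
Proof.
elim: Q P => [|g Q IHQ] P; last first.
  rewrite cylinder_consr -[X in measurable X]/(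
    coding @^-1` cylinder P Q `\` coding @^-1` cylinder (g :: P) Q).
  by apply: measurableD; exact: IHQ.
elim: P => [|g P IHP]; first by rewrite cylinder_nil preimage_setT.
rewrite cylinder_consl preimage_setI; apply: measurableI => //.
rewrite [X in measurable X](_ : _ = T g @^-1` A); first exact: measurable_translate.
by apply/seteqP; split => x; rewrite /= /coding inE.
Qed.

Lemma measurable_coding_open : countable [set: G] ->
  forall U : set {ptws G -> bool}, open U -> measurable (coding @^-1` U).
Proof.
move=> /cylinder_base[c cE] U /cE ->; rewrite preimage_bigcup.
by apply: bigcup_measurable => n _; exact: measurable_coding_cylinder.
Qed.

Context (E : set G) (F : nat -> {fset G}).
Hypothesis F0 : forall n, F n != fset0.
Hypothesis densE : forall (r : nat) (g : 'I_r -> G), (0 < r)%N ->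
  has_density F (\bigcap_i pullback (g i) E)
    (fine (mu (\bigcap_i (T (g i) @^-1` A)))).

(** Patterns of ones are the assumed correspondence, a zero is removed by
    [cylinder_consr] on both sides.  The empty pattern is separate, since the
    correspondence only speaks of nonempty intersections. *)
Lemma density_cylinder P Q :
  has_density F [set h | cylinder P Q (Defs.shift h (indicator_seq E))]
    (fine (mu (coding @^-1` cylinder P Q))).
Proof.
elim: Q P => [|g Q IHQ] P; last first.
  have sub : cylinder (g :: P) Q `<=` cylinder P Q.
    by rewrite cylinder_consl; exact: subIsetl.
  rewrite cylinder_consr /has_density.
  rewrite (_ : density_in R F _ = density_in R F
      [set h | cylinder P Q (Defs.shift h (indicator_seq E))] \-
    density_in R F [set h | cylinder (g :: P) Q (Defs.shift h (indicator_seq E))]).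
    rewrite (_ : fine _ = fine (mu (coding @^-1` cylinder P Q)) -
        fine (mu (coding @^-1` cylinder (g :: P) Q))).
      by apply: cvgB; exact: IHQ.
    rewrite -[X in mu X]/(
      coding @^-1` cylinder P Q `\` coding @^-1` cylinder (g :: P) Q).
    rewrite measureD//; try exact: measurable_coding_cylinder.
      rewrite fineB ?fin_num_measure//; try exact: measurable_coding_cylinder.
        by rewrite setIidr//; exact: preimage_subset.
      by apply: measurableI; exact: measurable_coding_cylinder.
    by rewrite ltey_eq fin_num_measure//; exact: measurable_coding_cylinder.
  by apply/funext => n; rewrite /= -density_inD// => h /sub.
case: P => [|g P].
  rewrite cylinder_nil preimage_setT probability_setT.
  rewrite /has_density (_ : density_in R F _ = fun=> 1); first exact: cvg_cst.
  by apply/funext => n; exact: density_inT.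
have := @densE (size (g :: P)) (tnth (in_tuple (g :: P))) isT.
rewrite [X in has_density _ X](_ : _ =
    [set h | cylinder (g :: P) [::] (Defs.shift h (indicator_seq E))]).
  rewrite (_ : \bigcap_i _ = coding @^-1` cylinder (g :: P) [::])//.
  apply/seteqP; split => [x Ax|x /= /andP[/allP Px _] i _].
    apply/andP; split => //; apply/allP => p /(tnthP (in_tuple (g :: P)))[i ->].
    by rewrite /coding inE; exact: Ax.
  by have := Px _ (mem_tnth i (in_tuple (g :: P))); rewrite /coding inE.
apply/seteqP; split => [h Eh|h /= /andP[/allP Ph _] i _].
  apply/andP; split => //; apply/allP => p /(tnthP (in_tuple (g :: P)))[i ->].
  by rewrite /Defs.shift /indicator_seq inE; exact: Eh.
have := Ph _ (mem_tnth i (in_tuple (g :: P))).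
by rewrite /Defs.shift /indicator_seq inE.
Qed.

(** The complement of the orbit closure is a countable union of cylinders that no
    translate of the indicator of E ever visits.  Their densities vanish
    identically, hence so do their measures. *)
Lemma coding_orbit_closure : countable [set: G] ->
  mu (~` (coding @^-1` orbit_closure E)) = 0%E.
Proof.
move=> cG; have [c cE] := cylinder_base cG.
have oU : open (~` orbit_closure E) by apply: closed_openC; exact: closed_closure.
rewrite preimage_setC; apply: measure_negligible.
  exact: measurable_coding_open.
rewrite (cE _ oU) preimage_bigcup bigcup_mkcond; apply: negligible_bigcup => n.
case: ifPn => [|_]; last exact: negligible_set0.
rewrite inE /= => nE; apply/negligibleP; first exact: measurable_coding_cylinder.
have := density_cylinder (c n).1 (c n).2.
rewrite [X in has_density _ X](_ : _ = set0); last first.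
  apply/seteqP; split => // h /= /nE; apply; apply: subset_closure.
  by exists h.
rewrite /has_density (_ : density_in R F set0 = fun=> 0); last first.
  by apply/funext => k; exact: density_in0.
move=> /(cvg_unique _ (cvg_cst _)) => /(_ _)/esym m0.
rewrite -[LHS]fineK ?m0// fin_num_measure//.
exact: measurable_coding_cylinder.
Qed.

End Coding.

(** * Topology of the orbit closure *)

Section SymbolicTopology.
Context {R : realType} {G : groupType} (E : set G).
Local Notation Y := (symbolic_space E).

Definition symbolic_cylinder P Q : set Y := val @^-1` cylinder P Q.

Lemma open_symbolicP (U : set Y) : open U <->
  exists2 V : set {ptws G -> bool}, open V & val @^-1` V = U.
Proof. by split => [[V oV VU]|[V oV VU]]; exists V. Qed.

Lemma measurable_symbolic_cylinder P Q :
  measurable (symbolic_cylinder P Q : set (borel_symbolic E)).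
Proof.
apply: sub_sigma_algebra; apply/open_symbolicP; exists (cylinder P Q) => //.
exact: open_cylinder.
Qed.

Lemma symbolic_cylinder_split g P Q :
  symbolic_cylinder P Q = symbolic_cylinder (g :: P) Q `|` symbolic_cylinder P (g :: Q).
Proof. by rewrite /symbolic_cylinder (cylinder_split g) preimage_setU. Qed.

Lemma symbolic_cylinder_disj g P Q :
  [disjoint symbolic_cylinder (g :: P) Q & symbolic_cylinder P (g :: Q)].
Proof.
apply/disj_setPS => y [yP].
by rewrite /symbolic_cylinder /= cylinder_consr => -[].
Qed.

Lemma agree_on_cylinder L P Q (y y' : Y) : {subset L <= P ++ Q} ->
  symbolic_cylinder P Q y -> symbolic_cylinder P Q y' ->
  agree L (val y) (val y').
Proof.
move=> LPQ /andP[/allP yP /allP yQ] /andP[/allP y'P /allP y'Q] g /LPQ.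
rewrite mem_cat => /orP[gP|gQ]; first by rewrite yP ?y'P.
by rewrite (negbTE (yQ _ gQ)) (negbTE (y'Q _ gQ)).
Qed.

Lemma compact_orbit_closure : compact (orbit_closure E).
Proof.
apply: (@subclosed_compact _ _
  [set y : {ptws G -> bool} | forall g, [set: bool] (y g)]).
- exact: closed_closure.
- by apply: (@tychonoff G (fun=> bool) (fun=> setT)) => _; exact: bool_compact.
- by [].
Qed.

Section ContinuousFunction.
Variable f : Y -> R.
Hypothesis cf : continuous f.

Lemma continuous_agree (y : Y) (t : R) : 0 < t -> exists L,
  forall y' : Y, agree L (val y) (val y') -> `|f y - f y'| < t.
Proof.
move=> t0; have : nbhs y (f @^-1` ball (f y) t) by apply: cf; exact: nbhsx_ballx.
rewrite nbhsE => -[U [/open_symbolicP[V oV <-] Vy] Ut].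
have [L LV] := nbhs_agree _ _ (open_nbhs_nbhs (conj oV Vy)).
by exists L => y' yy'; exact/Ut/LV.
Qed.

(** Uniform continuity, by compactness: pairs violating the modulus for every finite
    list L accumulate, along the filter of increasingly large lists, at a point
    where continuity of f is contradicted. *)
Lemma uniform_agree (t : R) : 0 < t -> exists L,
  forall y y' : Y, agree L (val y) (val y') -> `|f y - f y'| < t.
Proof.
move=> t0; apply: contrapT => nL.
have /choice[w wP] : forall L, exists w : Y * Y,
    agree L (val w.1) (val w.2) /\ t <= `|f w.1 - f w.2|.
  move=> L; apply: contrapT => nw; apply: nL; exists L => y y' yy'.
  by rewrite ltNge; apply/negP => tyy'; apply: nw; exists (y, y').
pose FL : set_system {ptws G -> bool} :=
  [set B | exists L : seq G, forall M : seq G, {subset L <= M} -> B (val (w M).1)].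
have FF : ProperFilter FL.
  split; first by move=> [L /(_ L)]; apply.
  split; first by exists [::].
    move=> B C [L LB] [M MC]; exists (L ++ M) => K LMK; split.
      by apply: LB => g gL; apply: LMK; rewrite mem_cat gL.
    by apply: MC => g gM; apply: LMK; rewrite mem_cat gM orbT.
  by move=> B C BC [L LB]; exists L => M LM; apply/BC/LB.
have [|p [Ep pcl]] := compact_orbit_closure FL FF.
  by exists [::] => M _; apply: set_mem; exact: (valP (w M).1).
pose y : Y := exist _ p (mem_set Ep).
have [L yL] := @continuous_agree y (t / 2) (divr_gt0 t0 (ltr0Sn _ 1)).
have [] := pcl [set z | exists2 M : seq G, {subset L <= M} & z = val (w M).1]
  [set z | agree L p z].
- by exists L => M LM; exists M.
- rewrite -agree_cylinder; apply: open_nbhs_nbhs; split; first exact: open_cylinder.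
  by rewrite agree_cylinder => g.
move=> _ [[M LM ->] pw]; have [w12] := wP M; apply/negP; rewrite -ltNge.
have p1 := yL _ pw; have p2 : `|f y - f (w M).2| < t / 2.
  by apply: yL => g gL; rewrite (w12 _ (LM _ gL)) pw.
rewrite (_ : f _ - f _ = (f y - f (w M).2) - (f y - f (w M).1)); last first.
  by rewrite opprB [RHS]addrC addrA subrK.
by rewrite (le_lt_trans (ler_normB _ _))// [ltRHS](splitr t) ltrD.
Qed.

Lemma measurable_continuous : measurable_fun [set: borel_symbolic E] f.
Proof.
apply: (measurability _ (RGenOpens.measurableE R)) => _ [_ [a [b ->] <-]].
rewrite setTI; apply: sub_sigma_algebra.
by have /continuousP := cf; apply; exact: interval_open.
Qed.

End ContinuousFunction.

End SymbolicTopology.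

(** Subdividing the whole space along the coordinates of L ends in patterns that
    prescribe all of L, so a property stable under gluing the two halves of a
    cylinder need only be known for those. *)
Lemma cylinder_ind {G : groupType} (p : seq G -> seq G -> Prop) (L : seq G) :
  (forall P Q, {subset L <= P ++ Q} -> p P Q) ->
  (forall g P Q, p (g :: P) Q -> p P (g :: Q) -> p P Q) ->
  p [::] [::].
Proof.
move=> base step.
(* M lists the coordinates that are not prescribed yet. *)
suff : forall M P Q, {subset L <= P ++ Q ++ M} -> p P Q by apply => g; exact.
elim=> [|g M IH] P Q LPQ; first by apply: base => h /LPQ; rewrite cats0.
apply: (step g); apply: IH => h /LPQ; rewrite !(mem_cat, in_cons).
  by case: (h == g); case: (h \in P); case: (h \in Q).
by case: (h == g); case: (h \in P); case: (h \in Q).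
Qed.

(** * Weak* convergence is convergence on cylinders *)

Section CylinderConvergence.
Context {R : realType} {G : groupType} (E : set G).
Local Notation Y := (borel_symbolic E).
Local Notation cyl := (symbolic_cylinder E).

Lemma bounded_continuous (f : symbolic_space E -> R) : continuous f ->
  exists M, forall y, `|f y| <= M.
Proof.
move=> cf; have [L fL] := uniform_agree E f cf 1 ltr01.
suff [M fM] : exists M, forall y, cyl [::] [::] y -> `|f y| <= M.
  by exists M => y; apply: fM; rewrite /symbolic_cylinder cylinder_nil.
apply: (@cylinder_ind G (fun P Q => exists M, forall y, cyl P Q y -> `|f y| <= M) L).
  move=> P Q LPQ.
  have [[y0 cy0]|nc] := pselect (exists y, cyl P Q y); last first.
    by exists 0 => y cy; exfalso; apply: nc; exists y.
  exists (1 + `|f y0|) => y cy; rewrite -[f y](subrK (f y0)).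
  rewrite (le_trans (ler_normD _ _))// lerD2r ltW//.
  by apply: fL; exact: (agree_on_cylinder E L P Q).
move=> g P Q [M1 fM1] [M2 fM2]; exists (Num.max M1 M2) => y.
rewrite (symbolic_cylinder_split E g) le_max => -[/fM1 ->//|/fM2 ->].
by rewrite orbT.
Qed.

Section UnitMass.
Context (m : {measure set Y -> \bar R}).
Hypothesis m1 : m setT = 1%E.
Implicit Types (f : symbolic_space E -> R) (B : set Y).

Lemma fin_num_unit_mass B : measurable B -> m B \is a fin_num.
Proof.
move=> mB; rewrite ge0_fin_numE// (@le_lt_trans _ _ 1%E) ?ltry//.
by rewrite -m1; apply: le_measure; rewrite ?inE.
Qed.

Lemma integrable_continuous f B : continuous f -> measurable B ->
  m.-integrable B (EFin \o f).
Proof.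
move=> cf mB; apply: measurable_bounded_integrable => //.
- by rewrite -ge0_fin_numE//; exact: fin_num_unit_mass.
- by apply: measurable_funTS; exact: measurable_continuous.
have [M fM] := bounded_continuous _ cf.
exists M; split; first exact: num_real.
by move=> x Mx y _; exact: le_trans (fM y) (ltW Mx).
Qed.

Lemma Rintegral_osc f (a t : R) B : continuous f -> measurable B ->
  (forall y, B y -> `|f y - a| <= t) ->
  `|(\int[m]_(y in B) f y) - a * fine (m B)| <= t * fine (m B).
Proof.
move=> cf mB fa; have cc (c : R) : continuous (fun _ : symbolic_space E => c).
  exact: cst_continuous.
have cfa : continuous (fun y => f y - a).
  by move=> y; apply: (@continuousB _ _ _ f (fun=> a)); [exact: cf|exact: cc].
rewrite -!Rintegral_cst//.
rewrite -RintegralB//; try exact: integrable_continuous.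
have norm_le := le_normr_Rintegral mB
  (@integrable_continuous (fun y => f y - a) B cfa mB).
apply: (le_trans norm_le) => {norm_le}.
apply: le_Rintegral => //.
  apply: (@integrable_continuous (fun y => `|f y - a|)) => //.
  move=> y; apply: (@continuous_comp _ _ _ (fun y => f y - a) (fun x : R => `|x|)).
    exact: cfa.
  exact: norm_continuous.
exact: (@integrable_continuous (fun=> t) B (cc t) mB).
Qed.

End UnitMass.

Context (m_ : nat -> {measure set Y -> \bar R}) (nu : {measure set Y -> \bar R}).
Hypothesis m1 : forall k, m_ k setT = 1%E.
Hypothesis nu1 : nu setT = 1%E.
Hypothesis mnu : forall P Q,
  fine (m_ k (cyl P Q)) @[k --> \oo] --> fine (nu (cyl P Q)).

(** On a cylinder where f oscillates by at most t / 4 both integrals are within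
    t / 4 times the mass of a constant times the mass, and the masses converge.
    The resulting error bound is proportional to the limit mass up to an arbitrary
    s, hence additive over the two halves of a cylinder, which is what
    [cylinder_ind] asks for.  No finite partition has to be summed over. *)
Lemma weak_star_cylinder : weak_star_cvg m_ nu.
Proof.
move=> f cf.
have fin (m : {measure set Y -> \bar R}) : m setT = 1%E ->
    (\int[m]_(x in [set: Y]) (f x)%:E)%E \is a fin_num.
  move=> mT; apply: (integrable_fin_num measurableT).
  exact: (integrable_continuous m mT f setT cf measurableT).
rewrite -(fineK (fin nu nu1)); apply: cvg_EFin; first by near=> k; exact: fin.
apply/cvgrPdist_le => t t0 /=.
have t4 : 0 < t / 4 by rewrite divr_gt0.
have [L fL] := uniform_agree E f cf _ t4.
have mc := measurable_symbolic_cylinder E.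
suff : forall s : R, 0 < s -> \forall k \near \oo,
    `|(\int[nu]_(y in cyl [::] [::]) f y) - \int[m_ k]_(y in cyl [::] [::]) f y|
      <= t / 4 * 2 * fine (nu (cyl [::] [::])) + s.
  have -> : cyl [::] [::] = setT by rewrite /symbolic_cylinder cylinder_nil.
  move=> /(_ _ (divr_gt0 t0 (ltr0Sn _ 1))).
  apply: filterS => k /le_trans; apply; rewrite nu1 mulr1.
  lra.
apply: (@cylinder_ind G (fun P Q => forall s : R, 0 < s -> \forall k \near \oo,
    `|(\int[nu]_(y in cyl P Q) f y) - \int[m_ k]_(y in cyl P Q) f y|
      <= t / 4 * 2 * fine (nu (cyl P Q)) + s) L); last first.
  move=> g P Q IHP IHQ s s0; have s2 : 0 < s / 2 by rewrite divr_gt0.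
  have [IP IQ] := (IHP _ s2, IHQ _ s2); near=> k.
  rewrite (symbolic_cylinder_split E g).
  have disj := symbolic_cylinder_disj E g P Q.
  rewrite !Rintegral_setU//;
    try by apply: integrable_continuous => //; exact: measurableU.
  rewrite measureU//; last exact/eqP.
  rewrite fineD ?fin_num_unit_mass//.
  have hP :
      `|(\int[nu]_(y in cyl (g :: P) Q) f y) - \int[m_ k]_(y in cyl (g :: P) Q) f y|
      <= t / 4 * 2 * fine (nu (cyl (g :: P) Q)) + s / 2 by near: k.
  have hQ :
      `|(\int[nu]_(y in cyl P (g :: Q)) f y) - \int[m_ k]_(y in cyl P (g :: Q)) f y|
      <= t / 4 * 2 * fine (nu (cyl P (g :: Q))) + s / 2 by near: k.
  rewrite opprD addrACA (le_trans (ler_normD _ _))// (le_trans (lerD hP hQ))//.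
  by rewrite (mulrDr (t / 4 * 2)) [X in _ <= _ + X](splitr s) [leRHS]addrACA.
move=> P Q LPQ s s0.
have [[y0 cy0]|nc] := pselect (exists y, cyl P Q y); last first.
  have -> : cyl P Q = set0.
    by apply/seteqP; split => // y cy; apply: nc; exists y.
  near=> k; rewrite !Rintegral_set0 subrr normr0 measure0 mulr0 add0r.
  exact: ltW.
have fy0 y : cyl P Q y -> `|f y - f y0| <= t / 4.
  by move=> cy; apply/ltW/fL; exact: (agree_on_cylinder E L P Q).
(* The difference v - u of the masses enters with the factor t / 4 through the
   oscillation and with the factor `|f y0| through the constant. *)
have q0 : 0 < s / (t / 4 + `|f y0|).
  by rewrite divr_gt0// ltr_pwDl.
have /cvgrPdist_le/(_ _ q0) mnus := mnu P Q.
near=> k.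
have hk : `|fine (nu (cyl P Q)) - fine (m_ k (cyl P Q))| <= s / (t / 4 + `|f y0|).
  by near: k.
have onu := Rintegral_osc nu nu1 f _ _ _ cf (mc P Q) fy0.
have omk := Rintegral_osc (m_ k) (m1 k) f _ _ _ cf (mc P Q) fy0.
move: (\int[nu]_(y in _) _) (\int[m_ k]_(y in _) _) onu omk hk => I J.
move: (fine (nu _)) (fine (m_ k _)) => u v onu omk.
rewrite ler_pdivlMr; last by rewrite ltr_pwDl.
move=> hk.
have -> : I - J = (I - f y0 * u) + f y0 * (u - v) - (J - f y0 * v) by ring.
apply: (@le_trans _ _ (t / 4 * u + `|f y0| * `|u - v| + t / 4 * v)).
  rewrite (le_trans (ler_normB _ _))// lerD// (le_trans (ler_normD _ _))// lerD//.
  by rewrite normrM.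
have vu : v <= u + `|u - v| by rewrite -lerBlDl -normrN opprB ler_norm.
have : t / 4 * v <= t / 4 * (u + `|u - v|) by rewrite ler_pM2l.
move: hk; set n := `|u - v|; have n0 : 0 <= n by exact: normr_ge0.
lra.
Unshelve. all: by end_near.
Qed.

End CylinderConvergence.

(** * Image measures and their completions *)

Lemma measure_eq_full d (X : measurableType d) (R : realType)
    (mu : {measure set X -> \bar R}) (X1 B C : set X) :
  measurable X1 -> mu (~` X1) = 0%E -> measurable B -> measurable C ->
  (forall x, X1 x -> B x <-> C x) -> mu B = mu C.
Proof.
move=> mX1 X10 mB mC BC.
have muI D : measurable D -> mu D = mu (D `&` X1).
  move=> mD; rewrite (measureDI mu mD mX1) [X in (X + _)%E](_ : _ = 0%E) ?add0e//.
  apply: measure_negligible; first exact: measurableD.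
  by exists (~` X1); split => //; exact: measurableC.
rewrite muI// [RHS]muI//; congr (mu _).
by apply/seteqP; split => x [+ X1x]; move=> /BC-/(_ X1x).
Qed.

Lemma image_probability d (X : measurableType d) d' (Y : measurableType d')
    (R : realType) (mu : probability X R) (phi : X -> Y) :
  measurable_fun setT phi ->
  exists nu : probability Y R, forall B, nu B = mu (phi @^-1` B).
Proof.
by move=> mphi; exists (distribution mu (mfun_Sub (mem_set mphi))).
Qed.

Lemma mp_system_completion (R : realType) (G : groupType) d
    (Y : measurableType d) (nu : probability Y R) (S : G -> Y -> Y) :
  mp_system nu S ->
  mp_system (completion nu) (S : G -> completion_type nu -> completion_type nu).
Proof.
move=> [S1 SM mS pS].
have mpre g B : measurable B -> measurable (S g @^-1` B).
  by move=> mB; rewrite -[X in measurable X]setTI; exact: mS.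
have sandwich g (B0 B L : set Y) : measurable B0 -> measurable L -> nu L = 0%E ->
    B0 `<=` B -> B `<=` B0 `|` L ->
    [/\ measurable (S g @^-1` B0), measurable (S g @^-1` L),
      nu (S g @^-1` L) = 0%E, S g @^-1` B0 `<=` S g @^-1` B &
      S g @^-1` B `<=` S g @^-1` B0 `|` S g @^-1` L].
  move=> mB0 mL L0 B0B BL; split.
  - exact: mpre.
  - exact: mpre.
  - by rewrite pS.
  - by move=> y; exact: B0B.
  - by move=> y; exact: BL.
split => //.
  move=> g _ B /completion_measurableP[B0 [L [mB0 mL L0 B0B BL]]].
  rewrite setTI; apply/completion_measurableP.
  by exists (S g @^-1` B0), (S g @^-1` L); exact: sandwich.
move=> g B /completion_measurableP[B0 [L [mB0 mL L0 B0B BL]]].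
have [mB0' mL' L0' B0B' BL'] := sandwich g _ _ _ mB0 mL L0 B0B BL.
apply: etrans (completion_between nu _ _ _ mB0' mL' L0' B0B' BL') _.
apply: etrans (pS g _ mB0) _.
exact: esym (completion_between nu _ _ _ mB0 mL L0 B0B BL).
Qed.

(** Completeness of mu is what makes the preimages of null sets of the target
    measurable; in the other direction measurability of images is the assumption. *)
Lemma mod0_isomorphism_completion {R : realType} {d} {X : measurableType d}
    {mu : probability X R} {d'} {Y : measurableType d'} {nu : probability Y R}
    {phi : X -> Y} {X' : set X} :
  measure_is_complete mu -> measurable_fun setT phi ->
  (forall B, nu B = mu (phi @^-1` B)) ->
  measurable X' -> mu (~` X') = 0%E -> {in X' &, injective phi} ->
  (forall A, measurable A -> A `<=` X' ->
    measurable (phi @` A : set (completion_type nu))) ->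
  @mod0_isomorphism R _ X mu _ (completion_type nu) (completion nu)
    X' (phi @` X') phi.
Proof.
move=> complete mphi nuE mX' X'0 X'inj im.
have mpre B : measurable B -> measurable (phi @^-1` B).
  by move=> mB; rewrite -[X in measurable X]setTI; exact: mphi.
have phi0 L : measurable L -> nu L = 0%E -> mu.-negligible (phi @^-1` L).
  by move=> mL L0; apply/negligibleP; [exact: mpre|exact: etrans (esym (nuE L)) L0].
have pre (B : set (completion_type nu)) : measurable B ->
    measurable (X' `&` phi @^-1` B) /\ mu (X' `&` phi @^-1` B) = completion nu B.
  move=> /completion_measurableP[B0 [L [mB0 mL L0 B0B BL]]].
  have mpB0 := mpre _ mB0.
  have mphiB : measurable (phi @^-1` B).
    rewrite [X in measurable X](_ : _ = phi @^-1` B0 `|` (phi @^-1` B `&` phi @^-1` L)).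
      apply: measurableU => //; apply: complete.
      by apply: negligibleS (phi0 _ mL L0); exact: subIsetr.
    apply/seteqP; split => x /=; last by case => [/B0B|[]].
    by move=> Bx; case: (BL _ Bx); [left|right].
  split; first exact: measurableI.
  apply: etrans _ (esym (completion_between nu _ _ _ mB0 mL L0 B0B BL)).
  apply: etrans _ (esym (nuE B0)).
  apply: (@measure_eq_full _ _ _ _ (X' `\` phi @^-1` L)) => //.
  - by apply: measurableD => //; exact: mpre.
  - apply: measure_negligible.
      by apply: measurableC; apply: measurableD => //; exact: mpre.
    rewrite setCD; apply: negligibleU; last exact: phi0.
    by apply/negligibleP => //; exact: measurableC.
  - exact: measurableI.
  - move=> x [X'x nLx]; split => [[_ /= /BL[//|/nLx]]//|/= /B0B Bx].
    by split.
split.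
- by [].
- split; first exact: im.
  have mCY : measurable (~` (phi @` X') : set (completion_type nu)).
    by apply: measurableC; exact: im.
  apply: etrans (esym (proj2 (pre _ mCY))) _.
  rewrite (_ : _ `&` _ = set0) ?measure0//.
  by apply/seteqP; split => // x [X'x /=]; apply; exists x.
- split; [by move=> x X'x; exists x|exact: X'inj|exact: subset_refl].
- by move=> B mB _; exact: (proj1 (pre _ mB)).
- by move=> B mB BX'; exact: im.
- by move=> B mB _; exact: (proj2 (pre _ mB)).
Qed.

Lemma measurable_borel d (X : measurableType d) (Y : ptopologicalType)
    (f : X -> borel_type Y) :
  (forall U : set Y, open U -> measurable (f @^-1` U)) -> measurable_fun setT f.
Proof.
move=> fU.
have E : @measurable _ (borel_type Y) = <<s @open Y >> by [].
by apply: (measurability _ E) => _ [U oU <-]; rewrite setTI; exact: fU.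
Qed.

Lemma measurable_symbolic_shift (G : groupType) (E : set G) g :
  measurable_fun [set: borel_symbolic E]
    (symbolic_shift g : borel_symbolic E -> borel_symbolic E).
Proof.
apply: measurable_borel => _ /open_symbolicP[V oV <-].
apply: sub_sigma_algebra; apply/open_symbolicP.
exists (Defs.shift g @^-1` V) => //.
by have /continuousP := @Defs.continuous_shift G g; apply.
Qed.

(** * The symbolic factor *)

Section SymbolicFactor.
Context {R : realType} {G : groupType} {d} {X : measurableType d}.
Context (mu : probability X R) (T : G -> X -> X) (A : set X) (E : set G).
Hypothesis countG : countable [set: G].
Hypothesis sysT : mp_system mu T.
Hypothesis mA : measurable A.
Let X1 := coding T A @^-1` orbit_closure E.
Hypothesis X1full : mu (~` X1) = 0%E.

(** The value at points coded outside the orbit closure is junk: they form a null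
    set, which is invariant because the orbit closure is. *)
Definition symbolic_factor (x : X) : borel_symbolic E :=
  insubd (symbolic_point E) (coding T A x).
Local Notation phi := symbolic_factor.

Lemma val_symbolic_factor x : X1 x -> val (phi x) = coding T A x.
Proof. by move=> X1x; rewrite /symbolic_factor insubdK//; exact: mem_set. Qed.

Lemma coding_orbit_closure_invariant g x : X1 x -> X1 (T g x).
Proof.
move=> X1x; rewrite /X1 /= (coding_equivariant mu _ _ sysT).
exact: orbit_closure_shift.
Qed.

Lemma symbolic_factor_equivariant g x :
  X1 x -> phi (T g x) = symbolic_shift g (phi x).
Proof.
move=> X1x; apply: val_inj; rewrite val_symbolic_factor; last first.
  exact: coding_orbit_closure_invariant.
by rewrite (coding_equivariant mu _ _ sysT) /= val_symbolic_factor.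
Qed.

Lemma measurable_coding_orbit_closure : measurable X1.
Proof.
rewrite -[X in measurable X]setCK; apply: measurableC.
rewrite /X1 preimage_setC; apply: (measurable_coding_open mu) => //.
by apply: closed_openC; exact: closed_closure.
Qed.

Lemma measurable_symbolic_factor : measurable_fun setT phi.
Proof.
apply: measurable_borel => _ /open_symbolicP[V oV <-].
have mX1 := measurable_coding_orbit_closure.
rewrite [X in measurable X](_ : _ = (X1 `&` coding T A @^-1` V) `|`
    (~` X1 `&` [set _ | V (indicator_seq E)])).
  apply: measurableU; apply: measurableI => //.
  - exact: (measurable_coding_open mu).
  - exact: measurableC.
  - have [VE|nVE] := pselect (V (indicator_seq E)).
      by rewrite [X in measurable X](_ : _ = setT)//; apply/seteqP; split.
    by rewrite [X in measurable X](_ : _ = set0)//; apply/seteqP; split.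
have out x : ~ X1 x -> val (phi x) = indicator_seq E.
  by move=> nX1x; rewrite /symbolic_factor /insubd insubN//; apply/negP; rewrite inE.
apply/seteqP; split => x /=.
  have [X1x|nX1x] := pselect (X1 x); first by rewrite val_symbolic_factor//; left.
  by rewrite out//; right.
move=> [[X1x]|[nX1x]]; first by rewrite -(val_symbolic_factor x X1x).
by rewrite -(out x nX1x).
Qed.

Lemma measurable_symbolic_preimage B : measurable B -> measurable (phi @^-1` B).
Proof.
move=> mB; rewrite -[X in measurable X]setTI; exact: measurable_symbolic_factor.
Qed.

Lemma symbolic_factor_cylinder P Q :
  mu (phi @^-1` symbolic_cylinder E P Q) = mu (coding T A @^-1` cylinder P Q).
Proof.
apply: (@measure_eq_full _ _ _ _ X1) => //.
- exact: measurable_coding_orbit_closure.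
- by apply: measurable_symbolic_preimage; exact: measurable_symbolic_cylinder.
- exact: (measurable_coding_cylinder mu).
by move=> x X1x; rewrite /symbolic_cylinder /= val_symbolic_factor.
Qed.

(** The sets that are preimages of Borel sets on X1 form a sigma-algebra, and
    [T g @` A] is the preimage of the condition that coordinate [g^-1] be one. *)
Lemma symbolic_factor_generated (C : set X) :
  <<s [set T g @` A | g in [set: G]] >> C ->
  exists2 D : set (borel_symbolic E), measurable D &
    forall x, X1 x -> C x <-> D (phi x).
Proof.
pose K := [set C : set X | exists2 D : set (borel_symbolic E), measurable D &
    forall x, X1 x -> C x <-> D (phi x)].
suff : <<s [set T g @` A | g in [set: G]] >> `<=` K by apply.
apply: smallest_sub.
  split.
  - by exists set0.
  - move=> B [D mD BD]; exists (~` D); first exact: measurableC.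
    move=> x /BD BDx; rewrite setTD; split => /= + H; [apply|apply]; exact/BDx.
  - move=> B /= KB.
    have /choice[D DP] : forall n, exists D : set (borel_symbolic E), measurable D /\
        forall x, X1 x -> B n x <-> D (phi x).
      by move=> n; have [D mD BD] := KB n; exists D.
    exists (\bigcup_n D n); first by apply: bigcupT_measurable => n; have [] := DP n.
    by move=> x X1x; split => -[n _ Bx]; exists n => //; have [_ H] := DP n; apply/H.
move=> _ [g _ <-].
exists (symbolic_cylinder E [:: g^-1%g] [::]).
  exact: measurable_symbolic_cylinder.
move=> x X1x; rewrite /symbolic_cylinder /cylinder /= val_symbolic_factor// !andbT.
rewrite /coding inE; split => [[y Ay <-]|Ax].
  by rewrite -(mp_actM sysT) mulVg (mp_act1 sysT).
by exists (T g^-1%g x) => //; rewrite -(mp_actM sysT) mulgV (mp_act1 sysT).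
Qed.

Lemma symbolic_factor_mp_system (nu : probability (borel_symbolic E) R) :
  (forall B, nu B = mu (phi @^-1` B)) ->
  mp_system nu (@symbolic_shift G E : G -> borel_symbolic E -> borel_symbolic E).
Proof.
move=> nuE; split.
- by move=> y; apply: val_inj; exact: shift1.
- by move=> g h y; apply: val_inj; exact: shiftM.
- by move=> g; exact: measurable_symbolic_shift.
move=> g B mB; rewrite !nuE -[RHS](mp_preserving sysT g); last first.
  exact: measurable_symbolic_preimage.
apply: (@measure_eq_full _ _ _ _ X1) => //.
- exact: measurable_coding_orbit_closure.
- apply: measurable_symbolic_preimage; rewrite -[X in measurable X]setTI.
  by apply: (measurable_symbolic_shift G E g).
- by apply: (measurable_translate mu) => //; exact: measurable_symbolic_preimage.
by move=> x X1x /=; rewrite symbolic_factor_equivariant.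
Qed.

Hypothesis leb : lebesgue_space mu.
Hypothesis genA : generated_by_translates mu T A.

(** The set provided by [factor_injective_bimeasurable] need not be invariant.  Its
    core X', the set of points all of whose translates stay in it, is invariant
    and still has full measure as G is countable; images of measurable subsets
    of X' remain measurable. *)
Lemma symbolic_factor_isomorphism (nu : probability (borel_symbolic E) R) :
  (forall B, nu B = mu (phi @^-1` B)) ->
  isomorphic_systems mu T (completion nu)
    (@symbolic_shift G E : G -> completion_type nu -> completion_type nu).
Proof.
move=> nuE.
have mX1 := measurable_coding_orbit_closure.
have [e esurj] := countable_surj _ 1%g countG.
have approx B : measurable B -> exists D M : set (borel_symbolic E),
  [/\ measurable D, measurable M, mu (phi @^-1` M) = 0%E &
      forall x, X1 x -> ~ M (phi x) -> B x <-> D (phi x)].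
  rewrite genA => -[C mC [N [M [mM M0 NM]] <-]].
  have [D mD CD] := symbolic_factor_generated _ mC.
  have [D' mD' MD'] := symbolic_factor_generated _ mM.
  exists D, D'; split => //.
    rewrite -M0; apply: (@measure_eq_full _ _ _ _ X1) => //.
    - exact: measurable_symbolic_preimage.
    - rewrite genA; exists M => //; exists set0; last by rewrite setU0.
      by exists set0; split => //; exact: measure0.
    - by move=> x /MD' [].
  move=> x X1x nD'; rewrite -CD//; split => [[//|/NM/MD'-/(_ X1x)//]|]; by left.
have [||X2 [mX2 X20 X2X1 X2inj X2im]] := @factor_injective_bimeasurable R _ X mu
    _ (borel_symbolic E) phi (fun n => symbolic_cylinder E [:: e n] [::]) X1 leb _ _
    measurable_symbolic_factor mX1 X1full approx.
- by move=> n; exact: measurable_symbolic_cylinder.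
- move=> y y' yy'; apply: val_inj; apply/funext => g; have [n <-] := esurj g.
  have := yy' n; rewrite /symbolic_cylinder /cylinder /= !andbT.
  by case: (_ y _); case: (_ y' _) => // -[H1 H2]; [have := H1 isT|have := H2 isT].
pose X' := \bigcap_n (T (e n) @^-1` X2).
have X'X2 : X' `<=` X2.
  move=> x X'x; have [n en] := esurj 1%g; have := X'x n I.
  by rewrite /= en (mp_act1 sysT).
have mX' : measurable X'.
  by apply: bigcapT_measurable => n; exact: (measurable_translate mu).
have X'0 : mu (~` X') = 0%E.
  apply: measure_negligible; first exact: measurableC.
  rewrite setC_bigcap; apply: negligible_bigcup => n; rewrite preimage_setC.
  have mC2 : measurable (~` X2) by exact: measurableC.
  apply/negligibleP; first exact: (measurable_translate mu).
  exact: etrans (mp_preserving sysT (e n) mC2) X20.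
have im B : measurable B -> B `<=` X' ->
    measurable (phi @` B : set (completion_type nu)).
  move=> mB BX'; apply/completion_measurableP.
  have [D [L [mD mL L0 DB BL]]] := X2im _ mB (subset_trans BX' X'X2).
  by exists D, L; split => //; exact: etrans (nuE L) L0.
have X'inj : {in X' &, injective phi}.
  move=> x x' /set_mem/X'X2 X2x /set_mem/X'X2 X2x'.
  exact: (X2inj x x' (mem_set X2x) (mem_set X2x')).
exists X', (phi @` X'), phi; split.
- exact: (mod0_isomorphism_completion (proj1 leb) measurable_symbolic_factor
    nuE mX' X'0 X'inj im).
- move=> g _ [x X'x <-] n _ /=; have [k ek] := esurj (e n * g)%g.
  by rewrite -(mp_actM sysT) -ek; exact: X'x.
- move=> g _ [_ [x X'x <-] <-]; exists (T g x).
    move=> n _ /=; have [k ek] := esurj (e n * g)%g.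
    by rewrite -(mp_actM sysT) -ek; exact: X'x.
  by rewrite symbolic_factor_equivariant//; apply/X2X1/X'X2.
- by move=> g x X'x; rewrite symbolic_factor_equivariant//; apply/X2X1/X'X2.
Qed.

End SymbolicFactor.

(** * Furstenberg systems are symbolic *)

Theorem theorem1p3 (R : realType) (G : groupType)
    (countableG : countable [set: G]) (amenableG : amenable R G)
    (F : nat -> {fset G}) (folnerF : folner R F)
    (E : set G) (densE : 0 < upper_density R F E)
    (d : measure_display) (X : measurableType d) (mu : probability X R)
    (T : G -> X -> X) (furstX : furstenberg_system E F mu T) :
  exists (N : nat -> nat) (nu : probability (borel_symbolic E) R),
    [/\ subseq_index N,
        weak_star_cvg (fun k => empirical R E (F (N k))) nu,
        mp_system (completion nu)
          (@symbolic_shift G E : G -> completion_type nu -> completion_type nu) &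
        isomorphic_systems mu T (completion nu)
          (@symbolic_shift G E : G -> completion_type nu -> completion_type nu)].
Proof.
have [leb sysT [A [mA _ [N subN dens] genA]]] := furstX.
have F0 n : (F \o N) n != fset0 by exact: folnerF.1.
have X1full := coding_orbit_closure mu T A sysT mA E (F \o N) F0 dens countableG.
have mphi := measurable_symbolic_factor mu T A E countableG sysT mA.
have [nu nuE] := image_probability _ _ _ _ _ mu _ mphi.
(* The sequence of indices realizing the densities serves as it is. *)
exists N, nu; split.
- exact: subN.
- apply: weak_star_cylinder.
  + by move=> k; rewrite (empirical_density (F \o N)) density_inT.
  + exact: probability_setT.
  + move=> P Q.
    have := density_cylinder mu T A sysT mA E (F \o N) F0 dens P Q.
    rewrite /has_density
      -(symbolic_factor_cylinder mu T A E countableG sysT mA X1full) -nuE.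
    rewrite [X in X @ _](_ : _ = fun k => fine
        (empirical R E (F (N k)) (symbolic_cylinder E P Q))); first exact.
    by apply/funext => k; rewrite (empirical_density (F \o N)).
- apply: mp_system_completion.
  exact: (symbolic_factor_mp_system mu T A E countableG sysT mA X1full).
- exact: (symbolic_factor_isomorphism mu T A E countableG sysT mA X1full leb genA).
Qed.
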